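(* For every $\varepsilon>0$ there exists an integer $n_0\geq 1$ such that for every $n\geq n_0$ the following holds: if $G$ is a bipartite multigraph whose edges are coloured with exactly $n$ colours such that each colour class is a matching of size at least $\left(\frac{3}{2}+\varepsilon\right)n$, then $G$ contains a rainbow matching of size $n$. Equivalently, $f(n)\leq \left(\frac32+\varepsilon\right)n$ for all $n\geq n_0$.
   Context: A bipartite multigraph may have several parallel edges between the same pair of vertices; in an edge-colouring each edge (including each parallel copy) receives exactly one colour. A matching is a set of pairwise vertex-disjoint edges. A rainbow matching is a matching whose edges have pairwise distinct colours (i.e., it contains at most one edge from each colour class). $f(n)$ denotes the smallest integer $m$ such that every bipartite edge-coloured multigraph with exactly $n$ colour classes, each of which is a matching of size at least $m$, contains a rainbow matching of size $n$. *)

(* Defs.v *)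
From HB Require Import structures.
From mathcomp Require Import all_boot all_order all_algebra.
Set Implicit Arguments. Unset Strict Implicit. Unset Printing Implicit Defensive.

(* A bipartite multigraph with parts V1, V2: a finite edge type E with an
   endpoint map ends : E -> V1 * V2 (parallel edges = distinct edges with the
   same endpoints).  An edge-colouring with n colours: col : E -> 'I_n. *)

Definition is_matching (V1 V2 E : finType) (ends : E -> V1 * V2) (S : {set E}) :=
  forall e f, e \in S -> f \in S -> e != f ->
    (ends e).1 != (ends f).1 /\ (ends e).2 != (ends f).2.

Definition colour_class (E : finType) (n : nat) (col : E -> 'I_n) (i : 'I_n)
  : {set E} := [set e | col e == i].

Definition is_rainbow_matching (V1 V2 E : finType) (n : nat)
  (ends : E -> V1 * V2) (col : E -> 'I_n) (S : {set E}) :=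
  is_matching ends S /\ {in S &, injective col}.

(* Main.v *)
Require Import Defs.
From HB Require Import structures.
From mathcomp Require Import all_boot all_order all_algebra.
From mathcomp Require Import boolp zify lra.
Import Order.TTheory GRing.Theory Num.Theory.

(* Rainbow matchings are enlarged one colour at a time.  Let M0 be a rainbow
   matching with colour set S that cannot be extended to S together with the
   missing colour c0.  Draw an arc c -> d when d is in S and the class of c has
   both an edge from outside M0 to the second endpoint of M0 d and an edge from
   the first endpoint of M0 d to outside M0.  Along a path c0 -> c -> d -> ...
   whose edges of the first kind are disjoint, the edges M0 c, M0 d, ... can be
   replaced one after the other, so that the last vertex becomes the missing
   colour.  Hence its class has no edge avoiding the current matching; counting
   its (3/2 + eps) n edges gives about 2 eps n out-neighbours.  An arc back to
   the path would give an augmentation through the edge of the second kind.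
   So it suffices to find a path of bounded length with such a return arc, and
   only boundedly many arcs at each vertex are lost to the disjointness
   condition.  Repeatedly take a ball that is almost closed under arcs, move to
   a vertex of large in-degree in it, and take a new ball there inside the old
   one: without a return arc the new ball misses all these in-neighbours, so
   the balls shrink linearly and vanish after boundedly many rounds. *)

(** * In-degrees and shrinking balls in a finite digraph *)

(** Counting the arcs inside [V] by tail and by head shows that out-degrees and in-degrees there
    have the same average. *)
Lemma exists_large_indegree (C : finType) (N : C -> {set C}) (V : {set C})
    (h : nat) :
  V != set0 -> (forall d, d \in V -> h <= #|N d :&: V|) ->
  exists2 c, c \in V & h <= #|[set d in V | c \in N d]|.
Proof.
move=> V0 hN; apply: contrapT => noc.
have small c : c \in V -> #|[set d in V | c \in N d]| < h.
  by move=> cV; rewrite ltnNge; apply/negP => hc; apply: noc; exists c.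
have card_sum (A : {set C}) (Q : pred C) :
    #|[set d in A | Q d]| = \sum_(d in A) Q d.
  rewrite -sum1dep_card big_mkcondr /=.
  by apply: eq_bigr => d _; case: (Q d).
have dbl : \sum_(d in V) #|N d :&: V| = \sum_(c in V) #|[set d in V | c \in N d]|.
  under [RHS]eq_bigr => c _ do rewrite card_sum.
  rewrite exchange_big /=; apply: eq_bigr => d _.
  by rewrite -card_sum; congr #|pred_of_set _|; apply/setP => c; rewrite !inE andbC.
have [c0 c0V] := set0Pn _ V0.
suff : \sum_(c in V) #|[set d in V | c \in N d]| < \sum_(d in V) #|N d :&: V|.
  by rewrite dbl ltnn.
rewrite (bigD1 c0) //= [ltnRHS](bigD1 c0) //= -addSn leq_add //.
  exact: leq_trans (small _ c0V) (hN _ c0V).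
apply: leq_sum => c /andP[cV _].
exact: leq_trans (ltnW (small _ cV)) (hN _ cV).
Qed.

Section BoundedPaths.
Context (C : finType) (N : C -> {set C}) (valid : C -> seq C -> Prop) (K : nat).
(* [valid c p] is a family of admissible paths ending in [c], with [p] the
   list of earlier vertices, latest first. *)
Hypothesis valid_notin : forall c p d, valid c p -> d \in N c -> d \notin c :: p.
Hypothesis valid_step : forall c p, valid c p ->
  exists2 bad : {set C}, #|bad| <= size p &
    forall d, d \in N c :\: bad -> valid d (c :: p).

(* A ball around [c] of radius less than [J] whose next layer has fewer than
   [s] vertices. *)
Lemma exists_almost_closed_ball (V : {set C}) (c : C) (p : seq C) (J s : nat) :
  valid c p -> c \in V -> size p + J <= K -> #|C| < J * s ->
  exists B : {set C}, [/\ B \subset V, c \in B &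
    forall d, d \in B ->
      (exists q, [/\ valid d q, c \in d :: q & size q <= size p + J]) /\
      #|N d :&: V| <= #|N d :&: B| + (s + K)].
Proof.
move=> cp cV pK CJ.
pose reach j d := exists q,
  [/\ valid d q, c \in d :: q & size q <= size p + j].
pose B j := [set d in V | `[< reach j d >]].
have BP j d : reflect (d \in V /\ reach j d) (d \in B j).
  by rewrite inE; apply: (iffP andP) => -[dV] /asboolP.
(* If each of [J] layers added [s] vertices, the last ball would exceed [C]. *)
have [j jJ Bj] : exists2 j, j < J & #|B j.+1| < #|B j| + s.
  apply: contrapT => noj.
  suff grow j : j <= J -> j * s <= #|B j|.
    by have := leq_trans (grow J (leqnn J)) (max_card (B J)); rewrite leqNgt CJ.
  elim: j => [//|j IH] jJ; rewrite mulSnr.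
  apply: leq_trans (_ : #|B j| + s <= _).
    by rewrite leq_add2r IH // ltnW.
  by rewrite leqNgt; apply/negP => ?; apply: noj; exists j.
have BS : B j \subset B j.+1.
  apply/subsetP => d /BP[dV [q [? ? qs]]]; apply/BP; split => //.
  by exists q; split => //; lia.
exists (B j); split.
- by apply/subsetP => d /BP[].
- by apply/BP; split => //; exists p; rewrite mem_head; split => //; lia.
move=> d /BP[dV [q [vq cq sq]]]; split; first by exists q; split => //; lia.
have [bad sbad vbad] := valid_step _ _ vq.
(* An arc from [d] that leaves the ball within [V] has a bad target or leads to the next layer. *)
have sub : (N d :&: V) :\: (N d :&: B j) \subset bad :|: (B j.+1 :\: B j).
  apply/subsetP => x; rewrite !inE => /andP[nB /andP[xN xV]].
  have [//|xbad /=] := boolP (x \in bad).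
  move: nB; rewrite xN xV /= => -> /=; apply/asboolP.
  exists (d :: q); split; first by apply: vbad; rewrite !inE xbad xN.
    by rewrite inE cq orbT.
  by rewrite /=; lia.
have := subset_leq_card sub.
have := cardsD (N d :&: V) (N d :&: B j).
have := cardsD (B j.+1) (B j).
rewrite (setIidPr BS).
have [+ _] := leq_card_setU bad (B j.+1 :\: B j).
have := subset_leq_card BS.
have := subset_leq_card (subsetIr (N d :&: V) (N d :&: B j)).
by move: sbad => /=; lia.
Qed.

(** Each of [R] rounds removes at least [h] vertices from a set that stays nonempty, against
    [#|C| <= R * h]. The [R.+1] balls lengthen paths by at most [J] each, hence the bound [K]. *)
Lemma no_large_outdegree (c0 : C) (g h s J R : nat) :
  valid c0 [::] ->
  (forall c p, valid c p -> size p <= K -> g <= #|N c|) ->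
  R.+1 * J <= K -> #|C| < J * s -> #|C| <= R * h ->
  h + R.+1 * (s + K) <= g -> False.
Proof.
move=> v0 deg KJ CJ CR hg.
suff H r : r <= R -> exists V : {set C},
    [/\ V != set0, #|V| + r * h <= #|C| & forall d, d \in V ->
      (exists q, valid d q /\ size q <= r.+1 * J) /\
      g <= #|N d :&: V| + r.+1 * (s + K)].
  have [V [V0 VC _]] := H R (leqnn R).
  by move: V0; rewrite -card_gt0; lia.
elim: r => [_|r IH rR].
  have [|B [_ cB hB]] := exists_almost_closed_ball setT c0 [::] J s v0 (in_setT _) _ CJ.
    by rewrite /=; nia.
  exists B; split; first by apply/set0Pn; exists c0.
    by rewrite addn0 max_card.
  move=> d /hB[[q [vq _ sq]] hN]; split; first by exists q; rewrite mul1n.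
  move: hN; rewrite setIT mul1n; apply: leq_trans.
  by apply: deg vq _; move: sq => /=; nia.
have [V [V0 VC hV]] := IH (ltnW rR).
have rK : r.+2 * J <= K by apply: leq_trans KJ; apply: leq_mul.
have rg : r.+2 * (s + K) <= R.+1 * (s + K) by apply: leq_mul.
have [d dV|c cV hc] := exists_large_indegree _ N V h V0.
  by have [_] := hV d dV; lia.
have [[p [vp sp]] _] := hV c cV.
have [|B [BV cB hB]] := exists_almost_closed_ball V c p J s vp cV _ CJ.
  by lia.
exists B; split; first by apply/set0Pn; exists c.
(* Every vertex of the new ball ends a valid path through [c], so it has no arc to [c]. *)
- suff : #|B| + #|[set d in V | c \in N d]| <= #|V| by lia.
  rewrite -(cardsID B V) (setIidPr BV) leq_add2l subset_leq_card //.
  apply/subsetP => d; rewrite !inE => /andP[-> cN]; rewrite andbT.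
  apply/negP => /hB[[q [vq cq _]] _].
  by have := valid_notin _ _ _ vq cN; rewrite cq.
move=> d dB; have [[q [vq _ sq]] hN] := hB d dB.
split; first by exists q; split => //; lia.
by have [_] := hV d (subsetP BV d dB); lia.
Qed.

End BoundedPaths.

(** * Switching a rainbow matching along a path of colours *)

Definition full_rainbow {V1 V2 E C : finType} (u : E -> V1) (v : E -> V2)
    (col : E -> C) (T : {set C}) (M : C -> E) :=
  [/\ {in T, forall c, col (M c) = c}, {in T &, injective (u \o M)}
    & {in T &, injective (v \o M)}].

Section Augmentation.
Context (V1 V2 E C : finType) (u : E -> V1) (v : E -> V2) (col : E -> C).
Hypothesis u_inj : forall e f, col e = col f -> u e = u f -> e = f.
Hypothesis v_inj : forall e f, col e = col f -> v e = v f -> e = f.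
Context (S : {set C}) (c0 : C) (M0 : C -> E).
Hypothesis c0S : c0 \notin S.
Hypothesis fullM0 : full_rainbow u v col S M0.
Hypothesis not_full : ~ exists M, full_rainbow u v col (c0 |: S) M.

Let T := c0 |: S.
Let X := [set u (M0 c) | c in S].
Let Y := [set v (M0 c) | c in S].
Let D1 c := [set d in S | [exists e, [&& col e == c, u e \notin X & v e == v (M0 d)]]].
Let D2 c := [set d in S | [exists e, [&& col e == c, v e \notin Y & u e == u (M0 d)]]].
Let N c := D1 c :&: D2 c.

(* The rainbow matching [M] misses only the colour [c]; it arises from [M0] by
   switching along the path with vertices [c :: p], and [ls] lists the
   newly covered vertices of the first side. *)
Record conf (c : C) (p : seq C) (ls : seq V1) (M : C -> E) : Prop := Conf {
  conf_sub : {subset c :: p <= T};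
  conf_c0 : c0 \in c :: p;
  conf_full : full_rainbow u v col (T :\ c) M;
  conf_out : forall d, d \in T -> d \notin c :: p -> M d = M0 d;
  conf_in : forall d, d \in p -> d != c -> u (M d) \in ls /\ v (M d) \in Y;
  conf_ls : {in ls, forall a, a \notin X};
  conf_size : size ls <= size p }.

Lemma conf_start : conf c0 [::] [::] M0.
Proof.
split=> //; try by move=> x; rewrite inE => /eqP->; rewrite setU11.
  by rewrite inE.
by rewrite /T setU1K.
Qed.

Lemma full_rainbow_sub (A B : {set C}) (M : C -> E) :
  A \subset B -> full_rainbow u v col B M ->
  full_rainbow u v col A M.
Proof.
move=> /subsetP AB [colM uM vM]; split.
- by move=> c /AB; apply: colM.
- by move=> c d /AB cB /AB dB; apply: uM.
- by move=> c d /AB cB /AB dB; apply: vM.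
Qed.

Lemma full_rainbow_upd (A : {set C}) (M : C -> E) (c : C) (e : E) :
  full_rainbow u v col (A :\ c) M -> col e = c ->
  (forall d, d \in A :\ c -> u e <> u (M d) /\ v e <> v (M d)) ->
  full_rainbow u v col A (fun d => if d == c then e else M d).
Proof.
move=> [colM uM vM] ce new; split=> [d dA /=|d d' dA d'A /=|d d' dA d'A /=].
- by have [->//|dc] := eqVneq d c; apply: colM; rewrite !inE dc.
- have [->|dc] := eqVneq d c; have [->|d'c] := eqVneq d' c => //.
  + by have [|nu nv] := new d'; [rewrite !inE d'c | move=> /nu].
  + by have [|nu nv] := new d; [rewrite !inE dc | move=> /esym/nu].
  + by apply: uM; rewrite !inE ?dc ?d'c.
- have [->|dc] := eqVneq d c; have [->|d'c] := eqVneq d' c => //.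
  + by have [|nu nv] := new d'; [rewrite !inE d'c | move=> /nv].
  + by have [|nu nv] := new d; [rewrite !inE dc | move=> /esym/nv].
  + by apply: vM; rewrite !inE ?dc ?d'c.
Qed.

Lemma conf_outS c p ls M d :
  conf c p ls M -> d \in T -> d \notin c :: p -> d \in S.
Proof.
move=> cf; rewrite in_setU1 => /orP[/eqP->|//].
by rewrite (conf_c0 _ _ _ _ cf).
Qed.

(* Otherwise [e] could be added to [M]. *)
Lemma conf_edge c p ls M e :
  conf c p ls M -> col e = c -> u e \notin ls -> v e \notin Y ->
  exists2 d, d \in S :\: [set x in c :: p] & u e = u (M0 d).
Proof.
move=> cf ce uls vY; apply: contrapT => nod; apply: not_full.
exists (fun d => if d == c then e else M d).
apply: full_rainbow_upd => //; first exact: conf_full cf.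
move=> d; rewrite in_setD1 => /andP[dc dT].
have [dp|dp] := boolP (d \in p).
  have [uM vM] := conf_in _ _ _ _ cf d dp dc.
  by split=> eM; [move: uls|move: vY]; rewrite eM (uM, vM).
have dcp : d \notin c :: p by rewrite inE negb_or dc.
have dS := conf_outS _ _ _ _ _ cf dT dcp.
rewrite (conf_out _ _ _ _ cf) //; split=> eM.
  by apply: nod; exists d => //; rewrite in_setD dS andbT inE.
by move: vY; rewrite eM imset_f.
Qed.

(** Colour [c] takes [e], whose first endpoint is free in [M] and whose second is used only by
    [M d]; dropping [M d] makes [d] the missing colour. *)
Lemma conf_switch c p ls M e d :
  conf c p ls M -> col e = c -> u e \notin X -> u e \notin ls ->
  d \in S -> v e = v (M0 d) -> d \notin c :: p ->
  conf d (c :: p) (u e :: ls) (fun x => if x == c then e else M x).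
Proof.
move=> cf ce uX uls dS ve dcp.
have dT : d \in T by rewrite in_setU1 dS orbT.
have Md : M d = M0 d by apply: conf_out cf d dT dcp.
have dc : d != c by apply: contraNneq dcp => ->; rewrite mem_head.
have [colM uM vM] := conf_full _ _ _ _ cf.
split.
- by move=> x; rewrite inE => /orP[/eqP->//|/(conf_sub _ _ _ _ cf)].
- by rewrite inE (conf_c0 _ _ _ _ cf) orbT.
- apply: full_rainbow_upd => //.
    by apply: full_rainbow_sub (conf_full _ _ _ _ cf); rewrite setSD ?subD1set.
  move=> x; rewrite !in_setD1 => /and3P[xc xd xT].
  split=> eM.
    have [xp|xp] := boolP (x \in p).
      by have [uMx _] := conf_in _ _ _ _ cf x xp xc; rewrite eM uMx in uls.
    have xcp : x \notin c :: p by rewrite inE negb_or xc.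
    move: uX; rewrite eM (conf_out _ _ _ _ cf) // imset_f //.
    exact: conf_outS cf xT xcp.
  have := vM d x; rewrite !in_setD1 dc xc dT xT /= Md -ve => /(_ isT isT eM) dx.
  by rewrite dx eqxx in xd.
- move=> x xT; rewrite inE negb_or => /andP[xd xcp].
  rewrite ifN; first exact: conf_out cf x xT xcp.
  by apply: contraNneq xcp => ->; rewrite mem_head.
- move=> x; rewrite inE; have [-> _ _|xc /= xp _] := eqVneq x c.
    by rewrite mem_head ve imset_f.
  by have [uMx vMx] := conf_in _ _ _ _ cf x xp xc; rewrite inE uMx orbT.
- by move=> a; rewrite inE => /orP[/eqP->|/(conf_ls _ _ _ _ cf)].
- exact: conf_size cf.
Qed.

Let valid c p := exists ls M, conf c p ls M.

(** By [conf_edge], the edge witnessing [D2] has its first endpoint on some [M0 d'] with [d'] off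
    the path, and [d' = d] since [M0] is a matching. *)
Lemma valid_notin c p d : valid c p -> d \in N c -> d \notin c :: p.
Proof.
move=> [ls [M cf]] /setIP[_]; rewrite inE => /andP[dS /existsP[e]].
move=> /and3P[/eqP ce vY /eqP ue].
have uls : u e \notin ls.
  by apply/negP => /(conf_ls _ _ _ _ cf); rewrite ue imset_f.
have [d' ] := conf_edge _ _ _ _ _ cf ce uls vY.
rewrite in_setD => /andP[d'cp d'S]; rewrite ue => eu.
have [_ uM0 _] := fullM0.
by move: d'cp; rewrite inE (uM0 d d').
Qed.

Lemma valid_step c p : valid c p ->
  exists2 bad : {set C}, #|bad| <= size p &
    forall d, d \in N c :\: bad -> valid d (c :: p).
Proof.
move=> vp; have [ls [M cf]] := vp.
pose G := [set e | (col e == c) && (u e \in ls)].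
(* Bad targets are those reached by an edge of colour [c] from [ls]: each vertex of [ls] has at most
   one such edge, whose second endpoint determines the target. *)
exists [set d in S | [exists e in G, v e == v (M0 d)]].
  apply: leq_trans (_ : #|G| <= _).
    have [_ _ vM0] := fullM0.
    rewrite -(card_in_imset (f := v \o M0)); last first.
      by move=> x y; rewrite !inE => /andP[xS _] /andP[yS _]; apply: vM0.
    apply: leq_trans (leq_imset_card v G); apply: subset_leq_card.
    apply/subsetP => _ /imsetP[d dH ->].
    move: dH; rewrite inE => /andP[_ /exists_inP[e eG /eqP ve]].
    by rewrite /= -ve imset_f.
  apply: leq_trans (conf_size _ _ _ _ cf).
  rewrite -(card_in_imset (f := u)); last first.
    by move=> x y; rewrite !inE => /andP[/eqP xc _] /andP[/eqP yc _]; apply: u_inj; rewrite xc.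
  apply: leq_trans (card_size ls); apply: subset_leq_card.
  by apply/subsetP => _ /imsetP[e eG ->]; move: eG; rewrite inE => /andP[].
move=> d; rewrite in_setD => /andP[dbad dN].
have dcp := valid_notin _ _ _ vp dN.
move: dN => /setIP[]; rewrite inE => /andP[dS /existsP[e]].
move=> /and3P[/eqP ce uX /eqP ve] _.
exists (u e :: ls), (fun x => if x == c then e else M x).
apply: conf_switch => //.
apply: contra dbad => els; rewrite inE dS /=; apply/exists_inP; exists e.
  by rewrite inE ce eqxx.
by rewrite ve.
Qed.

(** In the class of [c], at most [#|S|] edges meet [X] and at most [size p] meet [ls]; by
    [conf_edge] the others are counted by [D1]. The same holds for [Y] and [D2]. Both sets lie in
    [S], so inclusion-exclusion bounds their intersection from below. *)
Lemma valid_outdegree (m : nat) c p :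
  m <= #|[set e | col e == c]| -> valid c p ->
  2 * m <= 3 * #|S| + 2 * size p + #|N c|.
Proof.
move=> mc [ls [M cf]].
have sls := conf_size _ _ _ _ cf.
have inj_card (W : finType) (f : E -> W) (Q : pred E) (A : pred W) k :
    (forall e e', col e = col e' -> f e = f e' -> e = e') ->
    (forall e, col e = c -> Q e -> f e \in A) -> #|A| <= k ->
    #|[set e | (col e == c) && Q e]| <= k.
  move=> fi fA Ak; apply: leq_trans Ak.
  rewrite -(card_in_imset (f := f)); last first.
    by move=> x y; rewrite !inE => /andP[/eqP xc _] /andP[/eqP yc _]; apply: fi; rewrite xc.
  apply: subset_leq_card; apply/subsetP => _ /imsetP[e eQ ->].
  by move: eQ; rewrite inE => /andP[/eqP ce Qe]; apply: fA.
have cover (Q1 Q2 Q3 : pred E) : (forall e, [|| Q1 e, Q2 e | Q3 e]) ->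
    m <= #|[set e | (col e == c) && Q1 e]| + #|[set e | (col e == c) && Q2 e]|
         + #|[set e | (col e == c) && Q3 e]|.
  move=> Q; apply: leq_trans mc _.
  apply: leq_trans (_ : #|[set e | (col e == c) && Q1 e]
     :|: [set e | (col e == c) && Q2 e] :|: [set e | (col e == c) && Q3 e]| <= _).
    apply: subset_leq_card; apply/subsetP => e; rewrite !inE => -> /=.
    by rewrite -orbA Q.
  apply: leq_trans (leq_card_setU _ _) _.
  by rewrite leq_add2r leq_card_setU.
have lsb : #|[set e | (col e == c) && (u e \in ls)]| <= size p.
  apply: (inj_card _ u _ (mem ls)) => //.
  exact: leq_trans (card_size ls) sls.
have h1 : m <= #|S| + size p + #|D1 c|.
  apply: leq_trans (cover (fun e => u e \in X) (fun e => u e \in ls)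
     (fun e => (u e \notin X) && (u e \notin ls)) _) _.
    by move=> e; case: (u e \in X); case: (u e \in ls).
  apply: leq_add; first apply: leq_add => //.
    by apply: (inj_card _ u _ (mem X)) => //; apply: leq_imset_card.
  apply: (inj_card _ v _ (mem [set v (M0 d) | d in D1 c])) => //; last exact: leq_imset_card.
  move=> e ce /andP[uX uls].
  have vY : v e \in Y.
    apply: contraT => vY; have [d] := conf_edge _ _ _ _ _ cf ce uls vY.
    by rewrite in_setD => /andP[_ dS] ue; rewrite ue imset_f in uX.
  have [d dS ve] := imsetP vY; apply/imsetP; exists d => //.
  by rewrite inE dS; apply/existsP; exists e; rewrite ce uX ve !eqxx.
have h2 : m <= #|S| + size p + #|D2 c|.
  apply: leq_trans (cover (fun e => v e \in Y) (fun e => u e \in ls)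
     (fun e => (v e \notin Y) && (u e \notin ls)) _) _.
    by move=> e; case: (v e \in Y); case: (u e \in ls).
  apply: leq_add; first apply: leq_add => //.
    by apply: (inj_card _ v _ (mem Y)) => //; apply: leq_imset_card.
  apply: (inj_card _ u _ (mem [set u (M0 d) | d in D2 c])) => //; last exact: leq_imset_card.
  move=> e ce /andP[vY uls].
  have [d] := conf_edge _ _ _ _ _ cf ce uls vY.
  rewrite in_setD => /andP[_ dS] ue; apply/imsetP; exists d => //.
  by rewrite inE dS; apply/existsP; exists e; rewrite ce vY ue !eqxx.
have : #|D1 c :|: D2 c| <= #|S|.
  by apply: subset_leq_card; apply/subsetP => d; rewrite !inE => /orP[] /andP[].
have := cardsUI (D1 c) (D2 c).
by rewrite -/(N c); lia.
Qed.

Lemma missing_colour_contradiction (m h s J R : nat) :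
  (forall c, m <= #|[set e | col e == c]|) ->
  #|C| < J * s -> #|C| <= R * h ->
  3 * #|S| + 2 * (R.+1 * J) + (h + R.+1 * (s + R.+1 * J)) <= 2 * m -> False.
Proof.
move=> mc CJ CR hm.
apply: (no_large_outdegree C N valid (R.+1 * J) valid_notin valid_step c0
  (h + R.+1 * (s + R.+1 * J)) h s J R) => //.
  by exists [::], M0; exact: conf_start.
move=> c p vp sp.
have := valid_outdegree m c p (mc c) vp; lia.
Qed.

End Augmentation.

(** * Covering all colours and choosing the constants *)

Lemma exists_full_rainbow (V1 V2 E C : finType) (u : E -> V1) (v : E -> V2)
    (col : E -> C) (m h s J R : nat) :
  (forall e f, col e = col f -> u e = u f -> e = f) ->
  (forall e f, col e = col f -> v e = v f -> e = f) ->
  (forall c, m <= #|[set e | col e == c]|) ->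
  0 < m -> #|C| < J * s -> #|C| <= R * h ->
  3 * #|C| + 2 * (R.+1 * J) + (h + R.+1 * (s + R.+1 * J)) <= 2 * m ->
  exists M, full_rainbow u v col setT M.
Proof.
move=> ui vi mc m0 CJ CR hm.
suff H k : k <= #|C| -> exists (S : {set C}) M,
    #|S| = k /\ full_rainbow u v col S M.
  have [S [M [SC fM]]] := H #|C| (leqnn _).
  exists M; suff <- : S = setT by [].
  by apply/eqP; rewrite eqEcard subsetT cardsT SC leqnn.
elim: k => [_|k IH kC].
  (* Even the empty matching needs a total [M]; [0 < m] supplies an edge of each colour. *)
  have [M _] : exists M : C -> E, forall c, col (M c) = c.
    apply: (fin_all_exists (P := fun c e => col e = c)) => c.
    have := leq_trans m0 (mc c); rewrite card_gt0 => /set0Pn[e].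
    by rewrite inE => /eqP ce; exists e.
  exists set0, M; rewrite cards0; split => //.
  by split=> [c|c d|c d]; rewrite inE.
have [S [M [Sk fM]]] := IH (ltnW kC).
have [c0] : exists c0, c0 \in ~: S.
  by apply/set0Pn; rewrite -card_gt0 cardsCs setCK Sk subn_gt0.
rewrite inE => c0S; apply: contrapT => noM.
apply: (missing_colour_contradiction V1 V2 E C u v col ui vi S c0 M c0S fM _
  m h s J R mc CJ CR); last by lia.
move=> [M' fM']; apply: noM; exists (c0 |: S), M'; split => //.
by rewrite cardsU1 c0S Sk.
Qed.

Theorem theorem1 (R : archiRealFieldType) (eps : R) :
  (0 < eps)%R ->
  exists n0 : nat, (1 <= n0)%N /\
    forall n : nat, (n0 <= n)%N ->
    forall (V1 V2 E : finType) (ends : E -> V1 * V2) (col : E -> 'I_n),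
      (forall i : 'I_n,
         is_matching ends (colour_class col i) /\
         ((3 / 2 + eps) * n%:R <= (#|colour_class col i|)%:R)%R) ->
      exists S : {set E}, is_rainbow_matching ends col S /\ #|S| = n.
Proof.
move=> eps0.
pose t := Num.Def.archi_bound eps^-1.
have tP : (1 < eps * t%:R)%R.
  by rewrite -ltr_pdivrMl // mulr1 archi_boundP // invr_ge0 ltW.
have t0 : 0 < t by case: t tP => [|//]; rewrite mulr0 ltr10.
(* There are [2 * t] rounds after the first ball, hence [A] balls; [J] is chosen so that
   [A * (n %/ J) <= n %/ (2 * t)], and [f0] collects the error terms independent of [n]. *)
pose A := (2 * t).+1; pose J := 2 * t * A; pose K := A * J.
pose f0 := A + A * K + 2 * K.
exists (2 * t * f0.+1); split; first by rewrite !muln_gt0 t0.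
move=> n n_ge V1 V2 E ends col hcol.
pose f := n %/ (2 * t).
have t2 : 0 < 2 * t by rewrite muln_gt0.
have f_ge : f0 < f by rewrite leq_divRL // mulnC.
have fn : f * (2 * t) <= n by apply: leq_trunc_div.
have nf : n < f.+1 * (2 * t) by apply: ltn_ceil.
have sA : A * (n %/ J) <= f by rewrite /J divnMA mulnC leq_trunc_div.
have nJ : n < J * (n %/ J).+1 by rewrite mulnC ltn_ceil // muln_gt0 t2.
(* Since [n >= 2 * t * f] and [eps * t > 1], the excess [2 * eps * n] is at least [4 * f]: half of
   it pays for the in-degree [2 * f], half for the losses. *)
have card_ge c : 3 * n + 4 * f <= 2 * #|colour_class col c|.
  have [_] := hcol c.
  rewrite -(ler_nat R) natrD !natrM => hc.
  have : (4 * f%:R <= 2 * eps * n%:R :> R)%R.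
    have := fn; rewrite -(ler_nat R) !natrM => fnR.
    have f_pos : (0 <= f%:R :> R)%R by apply: ler0n.
    have : (f%:R * (2 * t%:R) * eps <= n%:R * eps :> R)%R.
      by rewrite ler_wpM2r // ltW.
    have : (f%:R <= f%:R * (eps * t%:R) :> R)%R by rewrite ler_peMr // ltW.
    lra.
  lra.
have end_inj (W : eqType) (g : V1 * V2 -> W) :
    (forall i e e', e \in colour_class col i -> e' \in colour_class col i ->
       e != e' -> g (ends e) != g (ends e')) ->
    forall e e', col e = col e' -> g (ends e) = g (ends e') -> e = e'.
  move=> gP e e' ce ge; apply/eqP; apply: contraT => ne.
  by have := gP (col e) e e'; rewrite !inE ce ge !eqxx => /(_ isT isT ne).
(* Rounding up with [uphalf] gives [3 * n + 4 * f <= 2 * m], and [m] is still a lower bound for the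
   integral class sizes. *)
have [|||||||M [colM uM vM]] := exists_full_rainbow V1 V2 E 'I_n
  (fun e => (ends e).1) (fun e => (ends e).2) col (uphalf (3 * n + 4 * f))
  (2 * f) (n %/ J).+1 J (2 * t).
- by apply: (end_inj _ fst) => i e e' ei e'i ne; have [/(_ e e' ei e'i ne)[]] := hcol i.
- by apply: (end_inj _ snd) => i e e' ei e'i ne; have [/(_ e e' ei e'i ne)[]] := hcol i.
- by move=> c; rewrite -[leqRHS]/(#|colour_class col c|); have := card_ge c; lia.
- by lia.
- by rewrite card_ord.
- rewrite card_ord (leq_trans (ltnW nf)) // mulnC leq_mul //.
  by move: f_ge; lia.
- rewrite card_ord -/A -/K mulnDr mulnSr.
  apply: leq_trans (_ : 3 * n + 4 * f <= _); last by lia.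
  by rewrite /f0 in f_ge; lia.
exists [set M c | c : 'I_n]; split; last first.
  by rewrite card_imset ?card_ord // => c d cd; rewrite -(colM c) // -(colM d) // cd.
split.
  move=> _ _ /imsetP[c _ ->] /imsetP[d _ ->] ne.
  split; apply: contra ne => /eqP eM; apply/eqP; congr M.
    exact: uM.
  exact: vM.
by move=> _ _ /imsetP[c _ ->] /imsetP[d _ ->]; rewrite !colM // => ->.
Qed.
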